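(* For every $\varepsilon > 0$ there is a constant $C_\varepsilon > 0$, depending only on $\varepsilon$, such that the following holds. Suppose that $G$ is a finite (possibly non-abelian) group and $A \subset G$ is a non-empty set with $|AA^{-1}| \leq (2-\varepsilon)|A|$. Then there is a subgroup $H$ of $G$ with $|H| \leq C_\varepsilon |A|$ such that $A$ is $C_\varepsilon$-covered on the left by $H$, i.e. there is a set $X \subset G$ with $|X| \leq C_\varepsilon$ such that $A \subset XH$.
   Context: For subsets $A, B$ of a group $G$, the product set is $AB := \{ab : a \in A, b \in B\}$, and $A^{-1} := \{a^{-1} : a \in A\}$, so $AA^{-1} = \{a a'^{-1} : a, a' \in A\}$. A set $A$ is $K$-covered (on the left) by a set $B$ if there is a set $X$ of at most $K$ elements such that $A \subset XB$. *)

(* Defs.v *)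
From mathcomp Require Import all_boot all_order all_algebra all_fingroup.
From mathcomp Require Import reals.

Set Implicit Arguments.
Unset Strict Implicit.
Unset Printing Implicit Defensive.

Local Open Scope ring_scope.

(* The ambient group is the whole type [gT]; [X * B] is the pointwise product. *)
Definition left_covered (R : realType) (gT : finGroupType) (K : R)
    (A B : {set gT}) : Prop :=
  exists2 X : {set gT}, #|X|%:R <= K & A \subset (X * B)%g.

(* Main.v *)
(* Hamidoune's isoperimetric method. For K = 1 - eps / 2, the function
   c(S) = |S A^-1| - K |S| is submodular and invariant under left translation,
   so two minimizers of c (among non-empty sets) that meet have an intersection
   minimizing c. Hence a minimizer H of least cardinality, translated so as to
   contain 1, equals its translates by inverses of its elements: it is a
   subgroup. If A meets exactly m left cosets of H, then c(H) <= c(A) reads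
   (m - K) |H| <= |A A^-1| - K |A| <= K |A| <= K m |H|, which bounds both m
   and |H| / |A|. *)

Require Import Defs.
From mathcomp Require Import all_boot all_order all_algebra all_fingroup.
From mathcomp Require Import reals.
From mathcomp Require Import lra.

Set Implicit Arguments.
Unset Strict Implicit.
Unset Printing Implicit Defensive.

Import Order.TTheory GRing.Theory Num.Theory.
Local Open Scope ring_scope.

Lemma submodular_min_group (R : realDomainType) (gT : finGroupType)
    (c : {set gT} -> R) :
    (forall x S, c (x *: S)%g = c S) ->
    (forall S T, c (S :|: T) + c (S :&: T) <= c S + c T) ->
  exists H : {group gT}, forall S, S != set0 -> c H <= c S.
Proof.
move=> cJ c_sub; have T_neq0 : [set: gT] != set0.
  by apply/set0Pn; exists 1%g; rewrite inE.
case: (@arg_minP _ _ _ _ (fun S => S != set0) c T_neq0) => M M_neq0 minM.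
have PM : (M != set0) && (c M == c M) by rewrite M_neq0 eqxx.
case: (@arg_minnP _ M (fun S => (S != set0) && (c S == c M)) (fun S => #|S|) PM).
move=> N /andP[/set0Pn[x Nx] /eqP cN] minN.
pose H := (x^-1 *: N)%g.
have cH : c H = c M by rewrite cJ.
have H1 : 1%g \in H by rewrite mem_lcoset invgK mulg1.
have HJ g : g \in H -> (g^-1 *: H)%g = H.
  move=> Hg; set H' := (g^-1 *: H)%g.
  have H'1 : 1%g \in H' by rewrite mem_lcoset invgK mulg1.
  have I0 : H :&: H' != set0 by apply/set0Pn; exists 1%g; rewrite inE H1.
  have U0 : H :|: H' != set0 by apply/set0Pn; exists 1%g; rewrite inE H1.
  (* Both [H] and [H'] have value [c M], and their union has at least that, so submodularity forces
     the intersection down to the minimum. *)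
  have cI : c (H :&: H') = c M.
    apply/eqP; rewrite eq_le minM // andbT.
    have := c_sub H H'; rewrite (cJ _ H) cH => le_c.
    have := minM _ U0; lra.
  have := minN (H :&: H'); rewrite I0 cI eqxx => /(_ isT).
  rewrite -(card_lcoset N x^-1%g) -/H => leHI.
  have HIH : H :&: H' = H by apply/eqP; rewrite eqEcard subsetIl.
  apply/esym/eqP; rewrite eqEcard card_lcoset leqnn andbT.
  by rewrite -{1}HIH subsetIr.
(* In a finite group, closure under products suffices: [h] lies in [H = g^-1 H], hence [g h] lies in
   [H]. *)
have gH : group_set H.
  apply/group_setP; split=> // g h Hg Hh.
  by rewrite -(HJ g Hg) in Hh; rewrite mem_lcoset invgK in Hh.
by exists (Group gH) => S S0; rewrite /= cH minM.
Qed.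

Lemma leq_card_mulg (gT : finGroupType) (S T : {set gT}) :
  (#|(S * T)%g| <= #|S| * #|T|)%N.
Proof.
by rewrite -cardsX [(S * T)%g]curry_imset2X leq_imset_card.
Qed.

(** Right multiplication by [B] commutes with unions and sends an intersection into the intersection
    of the products. *)
Lemma card_mulg_submodular (gT : finGroupType) (B S T : {set gT}) :
  (#|(S :|: T) * B| + #|(S :&: T) * B| <= #|S * B| + #|T * B|)%g%N.
Proof.
rewrite mulUg -[leqRHS]cardsUI leq_add2l subset_leq_card //.
by rewrite subsetI !mulSg ?subsetIl ?subsetIr.
Qed.

(** Inversion swaps the left cosets [a H] with the right cosets [H a^-1], which are disjoint, of
    size [#|H|], and lie in [H * A^-1]. *)
Lemma left_coset_cover (gT : finGroupType) (H : {group gT}) (A : {set gT}) :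
  exists2 X : {set gT},
    (#|X| * #|H| <= #|H * A^-1|)%g%N & A \subset (X * H)%g.
Proof.
exists [set (repr C)^-1%g | C in rcosets H A^-1%g].
  set P := rcosets H A^-1%g.
  have /and3P[_ tI _] := rcosets_partition_mul [set: gT] H.
  have /eqP sumP : trivIset P by apply: trivIsetS tI; exact/imsetS/subsetT.
  rewrite (leq_trans (leq_mul (leq_imset_card _ _) (leqnn _))) //.
  have -> : (#|P| * #|H| = #|cover P|)%N.
    rewrite -sumP -sum_nat_const.
    by apply: eq_bigr => _ /rcosetsP[x _ ->]; rewrite card_rcoset.
  apply/subset_leq_card/bigcupsP=> _ /rcosetsP[x Ax ->].
  by rewrite mulgS // sub1set.
apply/subsetP=> a Aa.
have /rcosetP[h Hh def_r] : repr (H :* a^-1)%g \in (H :* a^-1)%g.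
  exact: mem_repr (rcoset_refl _ _).
apply/mulsgP; exists (repr (H :* a^-1)%g)^-1%g h => //.
  by apply: imset_f; apply/rcosetsP; exists a^-1%g; rewrite ?memV_invg // inE invgK.
by rewrite def_r invMg invgK mulgKV.
Qed.

Theorem theorem1p2 (R : realType) (eps : R) (heps : 0 < eps) :
  exists2 C : R, 0 < C &
    forall (gT : finGroupType) (A : {set gT}),
      A != set0 ->
      #|(A * A^-1)%g|%:R <= (2 - eps) * #|A|%:R ->
      exists2 H : {group gT},
        #|H|%:R <= C * #|A|%:R & left_covered C A H.
Proof.
(* With K = 1 - [eps] / 2, this is 1 / (1 - K). *)
exists (2 / eps); first by rewrite divr_gt0.
move=> gT A A_neq0 leAA.
pose c (S : {set gT}) : R :=
  #|(S * A^-1)%g|%:R - (1 - eps / 2) * #|S|%:R.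
have cJ x S : c (x *: S)%g = c S.
  by rewrite /c -mulgA !card_lcoset.
have c_sub S T : c (S :|: T) + c (S :&: T) <= c S + c T.
  have := card_mulg_submodular A^-1%g S T; rewrite -(ler_nat R) !natrD.
  (* Cardinality is modular, so the term -K |S| contributes equally to both sides. *)
  have /(congr1 (fun n => n%:R : R)) := cardsUI S T; rewrite !natrD /c.
  nra.
have [H minH] := submodular_min_group cJ c_sub.
have [X leX sAXH] := left_coset_cover H A.
have cHA := minH A A_neq0.
have A_gt0 : 0 < #|A|%:R :> R by rewrite ltr0n card_gt0.
have H_ge1 : 1 <= #|H|%:R :> R by rewrite ler1n cardG_gt0.
have X_ge1 : 1 <= #|X|%:R :> R.
  rewrite ler1n card_gt0; apply: contraNneq A_neq0 => X0.
  by rewrite -subset0 (subset_trans sAXH) // X0 mul0g.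
have leA : #|A|%:R <= #|X|%:R * #|H|%:R :> R.
  by rewrite -natrM ler_nat (leq_trans (subset_leq_card sAXH)) ?leq_card_mulg.
(* This makes K positive, as needed to pass from [a <= m * h] to K a <= K m h. *)
have eps_le1 : eps <= 1.
  have leAAA : #|A|%:R <= #|(A * A^-1)%g|%:R :> R.
    have [a Aa] := set0Pn _ A_neq0.
    rewrite ler_nat -(card_rcoset A a^-1%g) subset_leq_card //.
    by rewrite mulgS // sub1set memV_invg.
  have : #|A|%:R * eps <= #|A|%:R * 1 by lra.
  by rewrite ler_pM2l.
move: leX; rewrite -(ler_nat R) natrM => leX.
rewrite /c in cHA.
set a := #|A|%:R in A_gt0 leA leAA cHA *; set h := #|H|%:R in H_ge1 leA leX cHA *.
set m : R := #|X|%:R in X_ge1 leA leX *.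
(* The hypothesis reads |A A^-1| <= 2 K a, so c(A) <= K a. *)
have main : (m - (1 - eps / 2)) * h <= (1 - eps / 2) * a by lra.
exists H; rewrite -?/h.
  (* Since [m >= 1], the left side of [main] is at least ([eps] / 2) h. *)
  rewrite mulrAC ler_pdivlMr //; nra.
exists X => //; rewrite -/m ler_pdivlMr //.
have : h * (m * eps) <= h * 2 by nra.
by rewrite ler_pM2l // (lt_le_trans _ H_ge1).
Qed.
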